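(* Assume that $D_0, D_1, D_2, \dots$ are mutually different. Let $j$ be a positive integer and let $k, m, m'$ be non-negative integers. If $k+j \leq m \leq m'$, then $D_k^{[j],(m+1)} = D_k^{[j],(m'+1)}$. In particular, $D_k^{[j],(m+1)} = D_k^{[j],(k+j+1)}$ under the condition $m \geq k+j$.
   Context: Let $\gamma \in \mathbb{C}$ with $\gamma \notin \{0,-1,-2,\dots\}$, and let $(D_m)_{m\ge 0}$, $(E_m)_{m\ge 0}$, $(F_m)_{m\ge 0}$ be sequences of complex numbers, independent of the variables $B$ and $s$. Define polynomials $c_m(B)$ in the variables $B$ and $s$ by $c_{-1}(B)=0$, $c_0(B)=1$ and $$c_{m+1}(B) = \frac{(B+D_m+sE_m)\,c_m(B) - sF_m\,c_{m-1}(B)}{(m+1)(m+\gamma)}, \quad m=0,1,2,\dots .$$ (The cases of interest have $D_m=m(m-1+\gamma+\delta)$ with: $E_m=m(m-1+\gamma+\epsilon)$, $F_m=(m-1+\alpha)(m-1+\beta)$, where $\gamma+\delta+\epsilon=\alpha+\beta+1$, for the Heun equation; $E_m=m$, $F_m=m-1+\alpha$ for the singly confluent Heun equation; $E_m=0$, $F_m=1$ for the reduced singly confluent Heun equation. For this $D_m$, mutual distinctness of $D_0,D_1,\dots$ is equivalent to $\gamma+\delta\notin\mathbb{Z}_{\le 0}$.) When $D_0,D_1,D_2,\dots$ are mutually different and $0\le k\le m$, the analytic implicit function theorem gives a unique germ of analytic function $D_{k,m+1}(s)$ at $s=0$ with $D_{k,m+1}(0)=D_k$ and $c_{m+1}(-D_{k,m+1}(s))=0$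 for all $s$ near $0$. Its Taylor coefficients are denoted by $D_k^{[j],(m+1)}$: $$D_{k,m+1}(s) = D_k + \sum_{j=1}^{\infty} D_k^{[j],(m+1)} s^j .$$ *)

(* Defs.v *)
From mathcomp Require Import all_boot all_order all_algebra.
From mathcomp Require Import polyXY complex.
From mathcomp Require Import all_classical all_reals all_analysis.
Set Implicit Arguments.
Unset Strict Implicit.
Unset Printing Implicit Defensive.
Import Order.TTheory GRing.Theory Num.Theory.
Import numFieldNormedType.Exports.
Local Open Scope classical_set_scope.
Local Open Scope ring_scope.

(* The definitions below are over an arbitrary [numFieldType], which carries
   the topology of its norm; they are meant to be used with K := R[i]. *)

(* c_m as a bivariate polynomial: the outer variable 'X is B and the inner
   variable 'Y = 'X%:P is s, so that (cpoly gamma D E F m).[b, s] is the value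
   at B = b and parameter s.  The [if n is p.+1] encodes c_{-1} = 0. *)
Fixpoint cpoly (K : numFieldType) (gamma : K) (D E F : nat -> K) (m : nat)
    : {poly {poly K}} :=
  if m is n.+1 then
    ((n.+1%:R * (n%:R + gamma))^-1)%:P%:P *
      (('X + (D n)%:P%:P + 'Y * (E n)%:P%:P) * cpoly gamma D E F n
       - 'Y * (F n)%:P%:P * (if n is p.+1 then cpoly gamma D E F p else 0))
  else 1.

(* f is represented near 0 by the convergent power series with coefficients a *)
Definition taylor_at0 (K : numFieldType) (a : nat -> K) (f : K -> K) : Prop :=
  \forall s \near (0 : K), series (fun n => a n * s ^+ n) @ \oo --> f s.

Definition analytic_at0 (K : numFieldType) (f : K -> K) : Prop :=
  exists a : nat -> K, taylor_at0 a f.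

(* f represents the germ D_{k,n}, for n = m + 1 with k <= m: the germ of
   analytic function at 0 with f 0 = D_k and c_n(- f s) = 0 for s near 0.
   By the implicit function theorem it exists and is unique as a germ when the
   D_i are pairwise distinct. *)
Definition is_root_germ (K : numFieldType) (gamma : K) (D E F : nat -> K)
    (k n : nat) (f : K -> K) : Prop :=
  [/\ analytic_at0 f,
      f 0 = D k
    & \forall s \near (0 : K), (cpoly gamma D E F n).[- f s, s] = 0].

(* Main.v *)
Require Import Defs.
From mathcomp Require Import all_boot all_order all_algebra.
From mathcomp Require Import polyXY complex.
From mathcomp Require Import all_classical all_reals all_analysis.
From mathcomp Require Import ring zify.
Import Order.TTheory GRing.Theory Num.Theory.
Import numFieldNormedType.Exports.
Local Open Scope ring_scope.

(** Write A for the germ of the root of c_(m'+1) that starts at D_k, and let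
    q_n be the order of vanishing at s = 0 of s |-> c_n(- A(s), s).  The
    recurrence, solved for its middle term, reads
      (D_n - A + s E_n) c_n = (n+1)(n+gamma) c_(n+1) + s F_n c_(n-1),
    and for n > k the factor on the left tends to D_n - D_k <> 0, so it can be
    cancelled: q_n >= min(q_(n+1), 1 + q_(n-1)).  As q_(m'+1) is infinite and
    q_k >= 0, these inequalities force q_n >= n - k for all n between k and
    m' + 1 ([cpoly_vanishing]): each step down from m' + 1 loses nothing, and
    each step up from k gains one.

    In particular, for k <= m <= m', the germ A solves c_(m+1) = 0 up to
    O(s^(m+1-k)).  At s = 0 the polynomial c_(m+1) is a nonzero multiple of
    prod_(l <= m) (B + D_l), which has - D_k as a simple root
    ([deriv_cpoly_at0_neq0]).  Hence an approximate root near - D_k is as close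
    to the exact one as its residual is small ([horner2_diff]), and A agrees
    up to O(s^(m+1-k)) with the germ of the root of c_(m+1).  Equal Taylor
    coefficients up to index m - k follow ([taylor_coef_eq]).

    Everything is carried out with orders of vanishing of functions, the only
    input from analysis being that a convergent power series differs from its
    N-th partial sum by O(s^N) ([taylor_tail]). *)

Set Implicit Arguments.
Unset Strict Implicit.

(** * Order of vanishing at the origin *)

(** This is g(s) = O(s^N).  The value at s = 0 is included, so for N > 0 the
    relation also gives g(0) = 0. *)
Definition vanishes (K : numFieldType) (N : nat) (g : K -> K) : Prop :=
  exists2 C : K, 0 <= C & \forall s \near (0 : K), `|g s| <= C * `|s| ^+ N.

Section Vanishing.
Variable K : numFieldType.
Implicit Types (f g h u v : K -> K) (s : K) (N M : nat).

Lemma near0_norm_lt (e : K) : 0 < e -> \forall s \near (0 : K), `|s| < e.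
Proof. exact: (@nbhs0_lt K K). Qed.

Lemma near0_neq0 (P : K -> Prop) :
  (\forall s \near (0 : K), P s) -> exists2 s, s != 0 & P s.
Proof.
move=> P0; have : (\forall s \near (0 : K)^'%classic, s != 0 /\ P s).
  by apply: filterI; [exact: (@nbhs_dnbhs_neq K) | exact: cvg_within].
by move/filter_ex => [s []]; exists s.
Qed.

Lemma near_vanishes N g h : (\forall s \near (0 : K), g s = h s) ->
  vanishes N g -> vanishes N h.
Proof.
move=> gh [C C0 gC]; exists C => //; near=> s.
have <- : g s = h s by near: s.
by near: s.
Unshelve. all: by end_near. Qed.

Lemma eq_vanishes N g h : g =1 h -> vanishes N g -> vanishes N h.
Proof. by move=> /funext ->. Qed.

Lemma vanishesD N g h : vanishes N g -> vanishes N h ->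
  vanishes N (fun s => g s + h s).
Proof.
move=> [C C0 gC] [C' C'0 hC']; exists (C + C'); first exact: addr_ge0.
near=> s; rewrite mulrDl (le_trans (ler_normD _ _)) // lerD //; by near: s.
Unshelve. all: by end_near. Qed.

Lemma vanishesM N M g h : vanishes N g -> vanishes M h ->
  vanishes (N + M) (fun s => g s * h s).
Proof.
move=> [C C0 gC] [C' C'0 hC']; exists (C * C'); first exact: mulr_ge0.
near=> s; rewrite exprD mulrACA normrM ler_pM //; by near: s.
Unshelve. all: by end_near. Qed.

Lemma vanishesW N M g : (M <= N)%N -> vanishes N g -> vanishes M g.
Proof.
move=> MN [C C0 gC]; exists C => //; have lt1 := near0_norm_lt ltr01.
near=> s; have s1 : `|s| <= 1.
  by apply: ltW; near: s.
rewrite (@le_trans _ _ (C * `|s| ^+ N)) //; first by near: s.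
by rewrite ler_wpM2l // ler_wiXn2l.
Unshelve. all: by end_near. Qed.

Lemma vanishes_cst (c : K) : vanishes 0 (fun _ : K => c).
Proof.
exists `|c| => //; near=> s; by rewrite expr0 mulr1.
Unshelve. all: by end_near. Qed.

Lemma vanishes_exp N : vanishes N (fun s => s ^+ N).
Proof.
exists 1 => //; near=> s; by rewrite mul1r normrX.
Unshelve. all: by end_near. Qed.

Lemma vanishes_id : vanishes 1 (fun s => s).
Proof. by apply: eq_vanishes (vanishes_exp 1) => s; rewrite expr1. Qed.

Lemma vanishesZ N (c : K) g : vanishes N g -> vanishes N (fun s => c * g s).
Proof. exact: vanishesM (vanishes_cst c). Qed.

Lemma vanishesN N g : vanishes N g -> vanishes N (fun s => - g s).
Proof. by move/(vanishesZ (-1)); apply: eq_vanishes => s; rewrite mulN1r. Qed.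

Lemma vanishesB N g h : vanishes N g -> vanishes N h ->
  vanishes N (fun s => g s - h s).
Proof. by move=> gN /vanishesN; exact: vanishesD. Qed.

Lemma vanishes0 N : vanishes N (fun _ : K => 0).
Proof.
by apply: eq_vanishes (vanishesZ 0 (vanishes_exp N)) => s; rewrite mul0r.
Qed.

Lemma vanishes_at0 N g : vanishes N.+1 g -> g 0 = 0.
Proof.
move=> [C _ /nbhs_singleton]; rewrite normr0 expr0n mulr0 normr_le0.
by move/eqP.
Qed.

Lemma vanishes_bounded g (c : K) :
  vanishes 1 (fun s => g s - c) -> vanishes 0 g.
Proof.
move=> gc; have := vanishesD (vanishesW (leq0n 1) gc) (vanishes_cst c).
by apply: eq_vanishes => s; rewrite subrK.
Qed.

(** A factor with a nonzero limit is bounded below near 0, in fact by half of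
    that limit, so it does not affect the order of vanishing. *)
Lemma vanishes_mul_cancel N u g (u0 : K) : u0 != 0 ->
  vanishes 1 (fun s => u s - u0) -> vanishes N (fun s => u s * g s) ->
  vanishes N g.
Proof.
move=> u0n0 [C C0 uC] [C' C'0 ugC'].
have u0_gt0 : 0 < `|u0| by rewrite normr_gt0.
exists (2 / `|u0| * C'); first by rewrite mulr_ge0 ?divr_ge0.
near=> s.
(* C + 1 replaces C because C may be 0 *)
have Cs : C * `|s| <= `|u0| / 2.
  apply: (@le_trans _ _ ((C + 1) * `|s|)); first by rewrite ler_wpM2r ?lerDl.
  rewrite mulrC -ler_pdivlMr ?ltr_wpDl // ltW //.
  by near: s; apply: near0_norm_lt; rewrite !divr_gt0 // ltr_wpDl.
have us : `|u0| / 2 <= `|u s|.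
  have : `|u s - u0| <= `|u0| / 2.
    by apply: le_trans Cs; rewrite -(expr1 `|s|); near: s.
  move=> H; have := lerB_normD u0 (u s - u0); rewrite (addrC u0) subrK.
  by apply: le_trans; rewrite lerBrDr [leRHS]splitr lerD2l.
have ugs : `|u s * g s| <= C' * `|s| ^+ N by near: s.
rewrite (_ : _ * _ = 2 * (C' * `|s| ^+ N) / `|u0|); last by ring.
rewrite ler_pdivlMr // mulrC.
rewrite (@le_trans _ _ (2 * (`|u s| * `|g s|))) //.
  by rewrite mulrA ler_wpM2r // mulrC -ler_pdivrMr.
by rewrite ler_pM2l // -normrM.
Unshelve. all: by end_near. Qed.

Lemma vanishes_monomial_eq0 N (c : K) :
  vanishes N.+1 (fun s => c * s ^+ N) -> c = 0.
Proof.
move=> [C C0 cC]; apply/eqP/negP => /negP cn0.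
have c_gt0 : 0 < `|c| by rewrite normr_gt0.
have small : \forall s \near (0 : K), `|s| < `|c| / (C + 1).
  by apply: near0_norm_lt; rewrite divr_gt0 ?ltr_wpDl.
have [s sn0 [cs]] := near0_neq0 (filterI cC small).
have s_gt0 : 0 < `|s| by rewrite normr_gt0.
rewrite ltr_pdivlMr ?ltr_wpDl // mulrDr mulr1 mulrC => sc.
move: cs; rewrite normrM normrX exprS mulrA ler_pM2r ?exprn_gt0 // => cs.
have := le_lt_trans cs (le_lt_trans _ sc).
by rewrite lerDl ltW // ltxx => /(_ isT).
Qed.

(** * Taylor expansions *)

(** At a nonzero point s0 of convergence the terms are eventually bounded, here
    by 2, so for |s| <= |s0| / 2 and M large the tail from M on is dominated by
    a geometric series of ratio 1/2 with first term 2 |s / s0|^M.  For a small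
    N, the finitely many terms between N and M are themselves O(s^N). *)
Lemma taylor_tail (a : nat -> K) f N : taylor_at0 a f ->
  vanishes N (fun s => f s - series (fun n => a n * s ^+ n) N).
Proof.
move=> af.
pose S s := series (fun n => a n * s ^+ n).
have [s0 s0n0 s0e] := near0_neq0 af.
have [n0 n0P] : exists n0, forall n, (n0 <= n)%N -> `|a n * s0 ^+ n| <= 2.
  have /cvgrPdist_le /(_ 1 ltr01) [n0 _ n0P] := s0e.
  exists n0 => n n0n; rewrite -(seriesSB (fun n => a n * s0 ^+ n)).
  rewrite (_ : _ - _ = (f s0 - S s0 n) - (f s0 - S s0 n.+1)); last first.
    by rewrite /S; ring.
  rewrite (le_trans (ler_normB _ _)) // (_ : 2 = 1 + 1) // lerD // n0P //=.
  exact: leqW.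
have large M : (n0 <= M)%N -> vanishes M (fun s => f s - S s M).
  move=> n0M; exists (4 / `|s0| ^+ M); first by rewrite divr_ge0.
  near=> s.
  pose r := `|s| / `|s0|.
  have r2 : r <= 2^-1.
    rewrite ler_pdivrMr ?normr_gt0 // ltW // mulrC.
    by near: s; apply: near0_norm_lt; rewrite divr_gt0 ?normr_gt0.
  have r0 : 0 <= r by rewrite divr_ge0.
  have partial d : `|S s (M + d)%N - S s M| <= 4 * r ^+ M * (1 - 2^-1 ^+ d).
    elim: d => [|d IH]; first by rewrite addn0 subrr normr0 expr0 subrr mulr0.
    rewrite addnS /S seriesSr -/(S s) addrAC (le_trans (ler_normD _ _)) //.
    have -> : 4 * r ^+ M * (1 - 2^-1 ^+ d.+1) =
        4 * r ^+ M * (1 - 2^-1 ^+ d) + 2 * (r ^+ M * 2^-1 ^+ d).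
      by rewrite exprS; field.
    apply: lerD => //.
    have -> : a (M + d)%N * s ^+ (M + d) =
        a (M + d)%N * s0 ^+ (M + d) * (s / s0) ^+ (M + d).
      by rewrite -mulrA -exprMn (mulrC s0) divfK.
    rewrite normrM ler_pM ?n0P ?(leq_trans n0M) ?leq_addr //.
    rewrite normrX normrM normfV -/r exprD ler_wpM2l ?exprn_ge0 //.
    by rewrite lerXn2r ?nnegrE ?invr_ge0.
  have sf : (S s @ \oo --> f s)%classic by near: s.
  rewrite (_ : 4 / _ * _ = 4 * r ^+ M); last by rewrite expr_div_n; ring.
  apply/ler_addgt0Pl => e e0; have /cvgrPdist_le /(_ _ e0) [n1 _ n1P] := sf.
  rewrite (_ : f s - S s M =
    (f s - S s (M + n1)%N) + (S s (M + n1)%N - S s M)); last by ring.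
  rewrite (le_trans (ler_normD _ _)) // lerD ?n1P //= ?leq_addl //.
  rewrite (le_trans (partial n1)) //.
  by rewrite ler_piMr ?mulr_ge0 ?exprn_ge0 // gerBl exprn_ge0.
have down d M : vanishes (M + d) (fun s => f s - S s (M + d)%N) ->
    vanishes M (fun s => f s - S s M).
  elim: d M => [|d IH] M; first by rewrite addn0.
  rewrite addnS -addSn => /IH fM.
  have := vanishesD (vanishesW (leqnSn M) fM) (vanishesZ (a M) (vanishes_exp M)).
  by apply: eq_vanishes => s; rewrite /S seriesSr; ring.
by apply: (down n0); apply: large; exact: leq_addl.
Unshelve. all: by end_near. Qed.

Lemma taylor_coef_eq (a b : nat -> K) f g N : taylor_at0 a f ->
  taylor_at0 b g -> vanishes N (fun s => f s - g s) ->
  forall i, (i < N)%N -> a i = b i.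
Proof.
move=> af bg fg; elim/ltn_ind => i IH iN.
apply/eqP; rewrite -subr_eq0; apply/eqP/(@vanishes_monomial_eq0 i).
have := vanishesB (vanishesW iN fg)
  (vanishesB (taylor_tail i.+1 af) (taylor_tail i.+1 bg)).
apply: eq_vanishes => s; rewrite !seriesSr.
suff -> : series (fun n => a n * s ^+ n) i = series (fun n => b n * s ^+ n) i.
  by ring.
rewrite !seriesEord /=; apply: eq_bigr => l _.
by rewrite IH // (ltn_trans _ iN).
Qed.

(** * Bivariate polynomials along a pair of germs *)

Lemma horner_sub0_vanishes (p : {poly K}) : vanishes 1 (fun s => p.[s] - p.[0]).
Proof.
elim/poly_ind: p => [|p c IH].
  by apply: eq_vanishes (vanishes0 1) => s; rewrite !horner0 subrr.
have := vanishesM (vanishes_bounded IH) vanishes_id.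
by apply: eq_vanishes => s; rewrite !hornerMXaddC; ring.
Qed.

Lemma horner2_sub0_vanishes (p : {poly {poly K}}) v (x0 : K) :
  vanishes 1 (fun s => v s - x0) ->
  vanishes 1 (fun s => p.[v s, s] - p.[x0, 0]).
Proof.
move=> vx; elim/poly_ind: p => [|p c IH].
  by apply: eq_vanishes (vanishes0 1) => s; rewrite !horner0 subrr.
have := vanishesD (vanishesD (vanishesM IH (vanishes_bounded vx))
  (vanishesZ p.[x0, 0] vx)) (horner_sub0_vanishes c).
apply: eq_vanishes => s; rewrite !hornerMXaddC !(hornerD, hornerM, hornerC).
move: p.[v s, s] p.[x0, 0] c.[s] c.[0] => P P0 C C0.
by ring.
Qed.

(** The difference quotient G tends to the partial derivative in the outer
    variable; if the latter is nonzero, [vanishes_mul_cancel] turns estimates on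
    the values of p into estimates on u - v. *)
Lemma horner2_diff (p : {poly {poly K}}) u v (x0 : K) :
  vanishes 1 (fun s => u s - x0) -> vanishes 1 (fun s => v s - x0) ->
  exists2 G, vanishes 1 (fun s => G s - p^`().[x0, 0]) &
    forall s, p.[u s, s] - p.[v s, s] = (u s - v s) * G s.
Proof.
move=> ux vx; elim/poly_ind: p => [|p c [G Gp Gdiff]].
  exists (fun=> 0); last by move=> s; rewrite !horner0 mulr0 subrr.
  by apply: eq_vanishes (vanishes0 1) => s; rewrite deriv0 !horner0 subrr.
exists (fun s => u s * G s + p.[v s, s]) => [|s]; last first.
  rewrite !hornerMXaddC !hornerE.
  rewrite (_ : _ - _ = u s * (p.[u s, s] - p.[v s, s])
     + p.[v s, s] * (u s - v s)); last by ring.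
  by rewrite Gdiff; ring.
have := vanishesD (vanishesD (vanishesM ux (vanishes_bounded Gp))
  (vanishesZ x0 Gp)) (horner2_sub0_vanishes p vx).
apply: eq_vanishes => s.
rewrite derivMXaddC !(hornerD, hornerM, hornerX, hornerC).
move: p.[v s, s] p.[x0, 0] p^`().[x0, 0] => P P0 P'.
by ring.
Qed.

(** * The polynomials c_m *)

Section Recurrence.
Variables (gamma : K) (D E F : nat -> K).
Hypothesis gammaP : forall n : nat, gamma <> - n%:R.
Hypothesis Dinj : injective D.
Local Notation c := (cpoly gamma D E F).

Lemma cpoly_den_neq0 n : n.+1%:R * (n%:R + gamma) != 0.
Proof.
rewrite mulf_neq0 ?pnatr_eq0 //; apply/eqP => /eqP.
by rewrite addrC addr_eq0 => /eqP /gammaP.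
Qed.

Lemma horner2_cpolyS n (x s : K) :
  n.+1%:R * (n%:R + gamma) * (c n.+1).[x, s] =
  (x + D n + s * E n) * (c n).[x, s] -
  s * F n * (if n is p.+1 then c p else 0).[x, s].
Proof.
rewrite /c -/c !(hornerD, hornerM, hornerN, hornerC, hornerX).
by rewrite mulVKf ?cpoly_den_neq0.
Qed.

Lemma cpoly_at0S n (x : K) : (c n.+1).[x, 0] =
  (n.+1%:R * (n%:R + gamma))^-1 * ((x + D n) * (c n).[x, 0]).
Proof.
apply/(mulfI (cpoly_den_neq0 n)).
rewrite horner2_cpolyS mulVKf ?cpoly_den_neq0 //.
by rewrite !mul0r addr0 subr0.
Qed.

Lemma deriv_cpoly_at0S n (x : K) : (c n.+1)^`().[x, 0] =
  (n.+1%:R * (n%:R + gamma))^-1 *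
    ((c n).[x, 0] + (x + D n) * (c n)^`().[x, 0]).
Proof.
rewrite /c -/c !(derivM, derivB, derivD, derivC, derivX).
rewrite !(hornerD, hornerM, hornerN, hornerC, hornerX).
by rewrite !(mul0r, mulr0, addr0, add0r, oppr0, mul1r).
Qed.

Lemma addD_neq0 k n : k != n -> - D k + D n != 0.
Proof.
by move=> kn; rewrite addrC subr_eq0; apply: contraNneq kn => /Dinj ->.
Qed.

Lemma cpoly_at0_neq0 k n : (n <= k)%N -> (c n).[- D k, 0] != 0.
Proof.
elim: n => [|n IH] nk; first by rewrite /= !hornerE oner_eq0.
rewrite cpoly_at0S !mulf_neq0 ?invr_neq0 ?cpoly_den_neq0 ?IH 1?ltnW //.
by rewrite addD_neq0 // gtn_eqF.
Qed.

Lemma cpoly_at0_eq0 k n : (k < n)%N -> (c n).[- D k, 0] = 0.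
Proof.
elim: n => // n IH; rewrite cpoly_at0S ltnS leq_eqVlt => /orP[/eqP <-|/IH->].
  by rewrite addNr mul0r mulr0.
by rewrite !mulr0.
Qed.

(** The root - D_k of c_n at s = 0 is simple: the factor B + D_k enters when
    passing from c_k to c_(k+1), and every later factor is nonzero there. *)
Lemma deriv_cpoly_at0_neq0 k n : (k < n)%N -> (c n)^`().[- D k, 0] != 0.
Proof.
elim: n => // n IH; rewrite deriv_cpoly_at0S mulf_eq0 invr_eq0.
rewrite (negPf (cpoly_den_neq0 _)) /= ltnS leq_eqVlt => /orP[/eqP <-|kn].
  by rewrite addNr mul0r addr0 cpoly_at0_neq0.
by rewrite cpoly_at0_eq0 // add0r mulf_neq0 ?IH // addD_neq0 // ltn_eqF.
Qed.

(** The heart of the matter: along an exact root of c_(M+1), the earlier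
    polynomials of the sequence vanish to order n - k.  The bound
    min(n - k, t) is improved one unit of t at a time, and for each t it is
    propagated downwards from n = M + 1, where the function is 0. *)
Lemma cpoly_vanishing f k M : (k <= M)%N ->
  vanishes 1 (fun s => f s - D k) ->
  (\forall s \near (0 : K), (c M.+1).[- f s, s] = 0) ->
  forall n, (k <= n <= M.+1)%N -> vanishes (n - k) (fun s => (c n).[- f s, s]).
Proof.
move=> kM fD fM.
have fN : vanishes 1 (fun s => - f s - - D k).
  by apply: eq_vanishes (vanishesN fD) => s; ring.
have bounded n : vanishes 0 (fun s => (c n).[- f s, s]).
  exact: vanishes_bounded (horner2_sub0_vanishes (c n) fN).
have main t n : (k <= n <= M.+1)%N ->
    vanishes (minn (n - k) t) (fun s => (c n).[- f s, s]).
  elim: t n => [|t IHt] n kn; first by rewrite minn0.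
  have [d] : exists d, (n + d = M.+1)%N by exists (M.+1 - n)%N; lia.
  elim: d n kn => [|d IHd] n /andP[kn nM] nd.
    rewrite addn0 in nd; rewrite nd.
    apply: near_vanishes (vanishes0 _); near=> s.
    by apply/esym; near: s.
  have := kn; rewrite leq_eqVlt => /orP[/eqP <-|]; first by rewrite subnn min0n.
  case: n kn nM nd => // n kn nM nd kn'.
  have hi : vanishes (minn (n.+2 - k) t.+1) (fun s => (c n.+2).[- f s, s]).
    by apply: IHd; lia.
  have lo : vanishes (minn (n - k) t) (fun s => (c n).[- f s, s]).
    by apply: IHt; lia.
  apply: (@vanishes_mul_cancel _ (fun s => - f s + D n.+1 + s * E n.+1) _
            (- D k + D n.+1)).
  - by rewrite addD_neq0 // ltn_eqF.
  - have := vanishesD fN (vanishesZ (E n.+1) vanishes_id).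
    by apply: eq_vanishes => s; ring.
  have hi' := vanishesZ (n.+2%:R * (n.+1%:R + gamma)) hi.
  have lo' := vanishesZ (F n.+1) (vanishesM vanishes_id lo).
  have le_hi : (minn (n.+1 - k) t.+1 <= minn (n.+2 - k) t.+1)%N by lia.
  have le_lo : (minn (n.+1 - k) t.+1 <= 1 + minn (n - k) t)%N by lia.
  have := vanishesD (vanishesW le_hi hi') (vanishesW le_lo lo').
  apply: eq_vanishes => s; rewrite horner2_cpolyS.
  move: (c n.+1).[_, _] (c n).[_, _] => P Q.
  by ring.
by move=> n kn; have := main (n - k)%N n kn; rewrite minnn.
Unshelve. all: by end_near. Qed.

Lemma root_germ_sub_vanishes k n f (a : nat -> K) :
  is_root_germ gamma D E F k n f -> taylor_at0 a f ->
  vanishes 1 (fun s => f s - D k).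
Proof.
move=> [_ f0 _] /(taylor_tail 1) fa; have := vanishes_at0 fa.
have a1 s : series (fun n => a n * s ^+ n) 1%N = a 0%N.
  by rewrite seriesEord /= big_ord1 expr0 mulr1.
rewrite a1 f0 => /eqP; rewrite subr_eq0 => /eqP ->.
by apply: eq_vanishes fa => s; rewrite a1.
Qed.

Lemma root_germ_coef_stable k m m' f g (a b : nat -> K) : (k <= m <= m')%N ->
  is_root_germ gamma D E F k m.+1 f -> taylor_at0 a f ->
  is_root_germ gamma D E F k m'.+1 g -> taylor_at0 b g ->
  forall j, (k + j <= m)%N -> a j = b j.
Proof.
move=> /andP[km mm'] fr af gr bg j kj.
have fD := root_germ_sub_vanishes fr af.
have gD := root_germ_sub_vanishes gr bg.
have [_ _ f0] := fr; have [_ _ g0] := gr.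
have gm : vanishes (m.+1 - k) (fun s => (c m.+1).[- g s, s]).
  by apply: (@cpoly_vanishing g k m') => //; lia.
have neg h : vanishes 1 (fun s => h s - D k) ->
    vanishes 1 (fun s => - h s - - D k).
  by move=> hD; apply: eq_vanishes (vanishesN hD) => s; ring.
have [G GD Gdiff] := horner2_diff (c m.+1) (neg _ gD) (neg _ fD).
apply: (@taylor_coef_eq a b f g (m.+1 - k)) => //; last by lia.
apply: (@vanishes_mul_cancel _ G _ _ _ GD); first exact: deriv_cpoly_at0_neq0.
apply: near_vanishes gm; near=> s.
rewrite (_ : G s * _ = (- g s - - f s) * G s); last by ring.
by rewrite -Gdiff (_ : (c m.+1).[- f s, s] = 0) ?subr0 //; near: s.
Unshelve. all: by end_near. Qed.

End Recurrence.
End Vanishing.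

Unset Implicit Arguments.
Set Strict Implicit.

(** * Stability of the Taylor coefficients *)

Theorem proposition4p7 (R : realType) (gamma : R[i]) (D E F : nat -> R[i])
    (Dgerm : nat -> nat -> R[i] -> R[i])
    (Dcoef : nat -> nat -> nat -> R[i])
    (gammaP : forall n : nat, gamma <> - n%:R)
    (Dinj : injective D)
    (DgermP : forall k m : nat, (k <= m)%N ->
       is_root_germ gamma D E F k m.+1 (Dgerm k m.+1))
    (DcoefP : forall k m : nat, (k <= m)%N ->
       taylor_at0 (Dcoef k m.+1) (Dgerm k m.+1)) :
  (forall j k m m' : nat, (0 < j)%N -> (k + j <= m)%N -> (m <= m')%N ->
     Dcoef k m.+1 j = Dcoef k m'.+1 j) /\
  (forall j k m : nat, (0 < j)%N -> (k + j <= m)%N ->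
     Dcoef k m.+1 j = Dcoef k (k + j).+1 j).
Proof.
have stable j k m m' : (k + j <= m)%N -> (m <= m')%N ->
    Dcoef k m.+1 j = Dcoef k m'.+1 j.
  move=> kjm mm'; have km : (k <= m)%N by lia.
  have km' : (k <= m')%N by lia.
  apply: (@root_germ_coef_stable _ _ D E F gammaP Dinj k m m'
    (Dgerm k m.+1) (Dgerm k m'.+1)); rewrite ?km //.
  - exact: DgermP.
  - exact: DcoefP.
  - exact: DgermP.
  - exact: DcoefP.
split=> [j k m m' _|j k m _ kjm]; first exact: stable.
by apply/esym/stable.
Qed.
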